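(* Let $q$ be a nonzero real number and let $n\ge 1$ be an integer. (Even spheres.) Let $\mathcal F=\mathbb{C}\langle x_0,x_i,x_i^*;\ i=1,\dots,n\rangle$ be the free algebra on $2n+1$ generators, made into a $*$-algebra by declaring $x_0$ self-adjoint and $x_i^*$ the adjoint of $x_i$. Define matrices $u_{(2j)}\in \mathrm{Mat}_{2^j}(\mathcal F)$ recursively by $u_{(0)}=x_0$ and $$u_{(2j)}=\begin{pmatrix} q^{-1}u_{(2j-2)} & x_j\\ x_j^* & -u_{(2j-2)}\end{pmatrix},\qquad j=1,\dots,n,$$ where $x_j$ and $x_j^*$ stand for $x_j$ and $x_j^*$ times the identity matrix of size $2^{j-1}$. Then the relations expressed by the matrix equation $u_{(2n)}^2=1$ generate the same two-sided ideal of $\mathcal F$ as the defining relations of $A(S^{2n}_q)$. That is, $A(S^{2n}_q)$ is the quotient of $\mathcal F$ by the relations $u_{(2n)}^2=1$ (together with $u_{(2n)}^*=u_{(2n)}$, which only expresses that $x_0$ is self-adjoint and $x_i^*$ is the adjoint of $x_i$). (Odd spheres.) Let $u_{(2n-1)}$ be the matrix obtained from $u_{(2n)}$ by setting $x_0=0$. Then, in the free $*$-algebra generated by $x_1,\dots,x_n$, the relations $u_{(2n-1)}^2=1$ are equivalent to the defining relations of $A(S^{2n-1}_q)$.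
   Context: The $*$-algebra $A(S^{2n}_q)$ of polynomial functions on the even quantum Euclidean sphere is the unital complex $*$-algebra generated by $x_0=x_0^*$, $x_i$, $x_i^*$ ($i=1,\dots,n$) with relations $$x_ix_j=q\,x_jx_i\quad (0\le i<j\le n),\qquad x_i^*x_j=q\,x_jx_i^*\quad (i\ne j),\qquad [x_i,x_i^*]=(1-q^{-2})s_{i-1}\quad (1\le i\le n),\qquad s_n=1,$$ where $s_0:=x_0^2$ and $s_i:=s_{i-1}+x_i^*x_i$. (The relation for $[x_i,x_i^*]$ is equivalent to $s_i=q^{-2}s_{i-1}+x_ix_i^*$.) The $*$-algebra $A(S^{2n-1}_q)$ of the odd sphere is generated by $x_i,x_i^*$ ($i=1,\dots,n$) with the same relations in which $x_0$ is set equal to $0$ (so $s_0=0$). *)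

(* Defs.v *)
From HB Require Import structures.
From mathcomp Require Import all_boot all_order all_algebra.
From mathcomp Require Import finmap.
From mathcomp.multinomials Require Import monalg.

Set Implicit Arguments.
Unset Strict Implicit.
Unset Printing Implicit Defensive.

Import GRing.Theory Num.Theory.
Local Open Scope ring_scope.

(* The monoid algebra of the free monoid on L, i.e. the free unital associative
   K-algebra on L. *)
Notation freealg K L := {malg K[{fmonom L}]} (only parsing).

Definition gen (K : fieldType) (L : choiceType) (l : L) : freealg K L :=
  << fmu l >>.

Record star_operation (K : numClosedFieldType) (A : lalgType K) (dag : A -> A) : Prop :=
  StarOperation {
    starD : forall f g, dag (f + g) = dag f + dag g;
    starZ : forall (a : K) f, dag (a *: f) = a^* *: dag f;
    starM : forall f g, dag (f * g) = dag g * dag f;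
    starK : involutive dag
  }.

(* The conjugate-linear anti-automorphism of the free algebra that sends each
   generator [gen l] to [gen (adj l)]: it conjugates the coefficients, and in
   each word reverses the order and applies [adj] letterwise. *)
Definition star (K : numClosedFieldType) (L : choiceType) (adj : L -> L)
    (f : freealg K L) : freealg K L :=
  \sum_(w <- msupp f) << (f@_w)^* *g FMonom (rev (map adj w)) >>.

Section StarTheory.
Variables (K : numClosedFieldType) (L : choiceType) (adj : L -> L).
Implicit Types (f g : freealg K L) (w : {fmonom L}).

Lemma star_gen l : star adj (gen K l) = gen K (adj l).
Proof.
rewrite /star msuppU oner_eq0 big_seq_fset1 mcoeffUU /gen.
by rewrite rmorph1 fmuE [fmu (adj l)]fmuE.
Qed.

Lemma starEw (d : {fset {fmonom L}}) f : (msupp f `<=` d)%fset ->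
  star adj f = \sum_(w <- d) << (f@_w)^* *g FMonom (rev (map adj w)) >>.
Proof.
move=> le; rewrite [LHS](big_fset_incl _ le) => //= x xd /mcoeff_outdom ->.
by rewrite rmorph0 monalgU0.
Qed.

Lemma starU (c : K) w :
  star adj << c *g w >> = << c^* *g FMonom (rev (map adj w)) >>.
Proof. by rewrite (starEw msuppU_le) big_seq_fset1 mcoeffUU. Qed.

Lemma star_additive f g : star adj (f + g) = star adj f + star adj g.
Proof.
rewrite (starEw (msuppD_le f g)) (starEw (fsubsetUl _ (msupp g))).
rewrite [star adj g](starEw (fsubsetUr (msupp f) _)) -big_split /=.
by apply: eq_bigr => w _; rewrite mcoeffD rmorphD monalgUD.
Qed.

Lemma star0 : @star K L adj 0 = 0.
Proof. by rewrite /star msupp0 big_seq_fset0. Qed.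

Lemma star_sum (I : Type) (r : seq I) (F : I -> freealg K L) :
  star adj (\sum_(i <- r) F i) = \sum_(i <- r) star adj (F i).
Proof. exact: (big_morph _ star_additive star0). Qed.

Lemma star_is_star : involutive adj -> star_operation (@star K L adj).
Proof.
move=> adjK; split.
- exact: star_additive.
- move=> a f; rewrite (starEw (msuppZ_le a f)) /star scaler_sumr.
  apply: eq_bigr => w _; rewrite mcoeffZ rmorphM.
  by apply/malgP => k; rewrite mcoeffZ !mcoeffU mulrnAr.
- move=> f g; rewrite malgME star_sum.
  under eq_bigr => v _ do rewrite star_sum.
  rewrite exchange_big /= [in RHS]/star mulr_suml.
  apply: eq_bigr => w _; rewrite mulr_sumr.
  apply: eq_bigr => v _; rewrite starU malgM_def fgmulUU rmorphM mulrC fmM.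
  rewrite map_cat rev_cat; congr (<< _ *g _ >>).
  by apply/eqP; rewrite fmP fmM.
- move=> f; rewrite [X in star adj X]/star star_sum [RHS]monalgE.
  apply: eq_bigr => w _; rewrite starU conjCK; congr (<< _ *g _ >>).
  apply/eqP; rewrite fmP /= map_rev revK -map_comp; apply/eqP.
  by rewrite (eq_map (g := id)) ?map_id // => l /=; rewrite adjK.
Qed.

End StarTheory.

Section Ideals.
Variables (K : fieldType) (A : lalgType K).

Record two_sided_ideal (I : A -> Prop) : Prop := TwoSidedIdeal {
  ideal0 : I 0;
  idealD : forall f g, I f -> I g -> I (f + g);
  idealM : forall a f b, I f -> I (a * f * b)
}.

Definition ideal_gen (S : A -> Prop) (f : A) : Prop :=
  forall I, two_sided_ideal I -> (forall g, S g -> I g) -> I f.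

End Ideals.

(* Relations imposed in a *-algebra come together with their adjoints. *)
Definition with_adjoints (A : Type) (dag : A -> A) (S : A -> Prop) (f : A) :=
  S f \/ exists2 g, S g & f = dag g.

(* In this section [x i] stands for x_i and [xs i] for x_i^* (0 <= i <= n). *)
Section Sphere.
Variables (K : fieldType) (A : lalgType K) (q : K) (n : nat).
Variables (x xs : 'I_n.+1 -> A).

Fixpoint sphere_s (i : nat) : A :=
  if i is i'.+1 then sphere_s i' + xs (inord i) * x (inord i)
  else x ord0 ^+ 2.

(* A relation lhs = rhs is recorded as the element lhs - rhs. *)
Inductive sphere_rel : A -> Prop :=
| sphere_rel_xx (i j : 'I_n.+1) : (i < j)%N ->
    sphere_rel (x i * x j - q *: (x j * x i))
| sphere_rel_xsx (i j : 'I_n.+1) : i != j ->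
    sphere_rel (xs i * x j - q *: (x j * xs i))
| sphere_rel_comm (i : 'I_n.+1) : (0 < i)%N ->
    sphere_rel ((x i * xs i - xs i * x i) - (1 - q ^- 2) *: sphere_s i.-1)
| sphere_rel_s : sphere_rel (sphere_s n - 1).

(* The size 2 ^ j in a form for which the block decomposition typechecks. *)
Fixpoint udim (j : nat) : nat := if j is j'.+1 then udim j' + udim j' else 1.

Lemma udimE j : udim j = (2 ^ j)%N.
Proof. by elim: j => //= j ->; rewrite expnS mul2n addnn. Qed.

(* [u_mx j] is u_(2j); indices j > n never occur in [u_mx n]. *)
Fixpoint u_mx (j : nat) : 'M[A]_(udim j) :=
  match j return 'M[A]_(udim j) with
  | 0 => (x ord0)%:M
  | j'.+1 =>
      block_mx ((q^-1)%:A *: u_mx j')     (x (inord j'.+1))%:M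
               (xs (inord j'.+1))%:M      (- u_mx j')
  end.

End Sphere.

Definition square_rel (K : fieldType) (A : lalgType K) m (U : 'M[A]_m) (f : A) :=
  exists a b, f = (U *m U - 1%:M) a b.

Definition adjoint_mx (A : Type) (dag : A -> A) m (M : 'M[A]_m) : 'M[A]_m :=
  map_mx dag M^T.

Section Generators.
Variables (K : fieldType) (n : nat).

(* (i, false) is the letter x_{i+1} and (i, true) the letter x_{i+1}^*;
   in the even case None is the letter x_0. *)
Definition odd_letter : choiceType := ('I_n * bool)%type.
Definition even_letter : choiceType := option ('I_n * bool).

Definition odd_adj (l : odd_letter) : odd_letter := (l.1, ~~ l.2).
Definition even_adj : even_letter -> even_letter := omap odd_adj.

Definition even_x (i : 'I_n.+1) : freealg K even_letter :=
  if unlift ord0 i is Some j then gen K (Some (j, false) : even_letter)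
  else gen K (None : even_letter).

Definition even_xs (i : 'I_n.+1) : freealg K even_letter :=
  if unlift ord0 i is Some j then gen K (Some (j, true) : even_letter)
  else gen K (None : even_letter).

(* The odd case is the even one with x_0 set equal to 0. *)
Definition odd_x (i : 'I_n.+1) : freealg K odd_letter :=
  if unlift ord0 i is Some j then gen K ((j, false) : odd_letter) else 0.

Definition odd_xs (i : 'I_n.+1) : freealg K odd_letter :=
  if unlift ord0 i is Some j then gen K ((j, true) : odd_letter) else 0.

Lemma odd_adjK : involutive odd_adj.
Proof. by case=> i b; rewrite /odd_adj /= negbK. Qed.

Lemma even_adjK : involutive even_adj.
Proof. by case=> //= l; rewrite odd_adjK. Qed.

End Generators.

Arguments even_x K {n} i.
Arguments even_xs K {n} i.
Arguments odd_x K {n} i.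
Arguments odd_xs K {n} i.

Section Spheres.
Variables (K : numClosedFieldType) (n : nat).

Definition even_star : freealg K (even_letter n) -> freealg K (even_letter n) :=
  star (@even_adj n).

Definition odd_star : freealg K (odd_letter n) -> freealg K (odd_letter n) :=
  star (@odd_adj n).

Lemma even_star_x i : even_star (even_x K i) = even_xs K i.
Proof.
by rewrite /even_star /even_x /even_xs; case: unlift => [j|]; rewrite star_gen.
Qed.

Lemma odd_star_x i : odd_star (odd_x K i) = odd_xs K i.
Proof.
by rewrite /odd_star /odd_x /odd_xs; case: unlift => [j|];
  rewrite ?star_gen ?star0.
Qed.

Lemma even_star_is_star : star_operation even_star.
Proof. exact/star_is_star/even_adjK. Qed.

Lemma odd_star_is_star : star_operation odd_star.
Proof. exact/star_is_star/odd_adjK. Qed.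

Variable q : K.

(* The defining relations of A(S^{2n}_q) and of A(S^{2n-1}_q). *)
Definition even_sphere_rel : freealg K (even_letter n) -> Prop :=
  with_adjoints even_star (sphere_rel q (even_x K) (even_xs K)).

Definition odd_sphere_rel : freealg K (odd_letter n) -> Prop :=
  with_adjoints odd_star (sphere_rel q (odd_x K) (odd_xs K)).

(* u_(2n) and u_(2n-1) *)
Definition even_u : 'M[freealg K (even_letter n)]_(udim n) :=
  u_mx q (even_x K) (even_xs K) n.

Definition odd_u : 'M[freealg K (odd_letter n)]_(udim n) :=
  u_mx q (odd_x K) (odd_xs K) n.

End Spheres.

(* Main.v *)
Require Import Defs.
From mathcomp Require Import all_boot all_order all_algebra.
From mathcomp Require Import finmap.
From mathcomp.multinomials Require Import monalg.
From mathcomp.real_closed Require Import complex.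
From mathcomp Require Import reals.
Import GRing.Theory.
Local Open Scope ring_scope.

Set Implicit Arguments.
Unset Strict Implicit.
Unset Printing Implicit Defensive.

(** Write [U] for [u_(2j)], [y] and [ys] for [x_(j+1)] and its adjoint. The
    blocks of [u_(2j+2)^2 = t] say that [U^2 = t - ys y] is again scalar, that
    [q^-2 (t - ys y) + y ys = t], and that [y] and [ys] q-commute with the
    entries of [U], which are multiples of the lower generators. Descending
    from [t = 1] at [j = n], the scalars reach [x_0^2] at [j = 0], so they must
    be the [s_j]; the first diagonal block is then the commutator relation.
    This is carried out modulo an arbitrary two-sided ideal [I]: two sets of
    relations generate the same ideal when the same ideals contain them. *)

(** * Two-sided ideals and matrices with entries in an ideal *)

Section IdealTheory.
Variables (K : fieldType) (A : lalgType K) (I : A -> Prop).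
Hypothesis idI : two_sided_ideal I.

Lemma idealZ (a : K) f : I f -> I (a *: f).
Proof.
by move=> If; have := idealM idI (a *: 1) 1 If; rewrite mulr1 -scalerAl mul1r.
Qed.

Lemma idealN f : I f -> I (- f).
Proof. by rewrite -scaleN1r; apply: idealZ. Qed.

Lemma idealZE (a : K) f : a != 0 -> I (a *: f) <-> I f.
Proof.
move=> a0; split; last exact: idealZ.
by move=> /(idealZ a^-1); rewrite scalerA mulVf // scale1r.
Qed.

Lemma ideal_congr f g : I (f - g) -> I f <-> I g.
Proof.
move=> Ifg; split=> [If|Ig]; last by rewrite -(subrK g f); apply: idealD.
by rewrite -(subKr f g); apply: idealD => //; apply: idealN.
Qed.

Definition mx_in_ideal m p (M : 'M[A]_(m, p)) := forall a b, I (M a b).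

Lemma mx_in_ideal_block m1 m2 p1 p2 (M1 : 'M[A]_(m1, p1)) (M2 : 'M_(m1, p2))
    (M3 : 'M_(m2, p1)) (M4 : 'M_(m2, p2)) :
  mx_in_ideal (block_mx M1 M2 M3 M4) <->
  (mx_in_ideal M1 /\ mx_in_ideal M2) /\ (mx_in_ideal M3 /\ mx_in_ideal M4).
Proof.
split=> [IM|[[I1 I2] [I3 I4]] a b].
  split; split=> a b.
  - by rewrite -(block_mxEul M1 M2 M3 M4).
  - by rewrite -(block_mxEur M1 M2 M3 M4).
  - by rewrite -(block_mxEdl M1 M2 M3 M4).
  - by rewrite -(block_mxEdr M1 M2 M3 M4).
by rewrite !mxE; case: (split a) => a'; rewrite !mxE; case: (split b) => b'.
Qed.

Lemma mx_in_ideal_scalar m (f : A) : (0 < m)%N ->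
  mx_in_ideal (f%:M : 'M_m) <-> I f.
Proof.
move=> m0; split=> [/(_ (Ordinal m0) (Ordinal m0))|If a b].
  by rewrite mxE eqxx.
by rewrite mxE; case: eqP => _ //=; apply: ideal0.
Qed.

Lemma mx_in_ideal_congr m p (M N : 'M[A]_(m, p)) :
  mx_in_ideal (M - N) -> mx_in_ideal M <-> mx_in_ideal N.
Proof.
move=> IMN; split=> IM a b; have := IMN a b; rewrite !mxE => ImN.
  exact/(ideal_congr ImN).
exact/(ideal_congr ImN).
Qed.

End IdealTheory.

Lemma udim_gt0 j : (0 < udim j)%N.
Proof. by rewrite udimE expn_gt0. Qed.

Lemma mulmx_scalarE (A : pzRingType) m (M : 'M[A]_m) (y : A) a b :
  (M *m y%:M) a b = M a b * y.
Proof.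
rewrite mxE (bigD1 b) //= mxE eqxx big1 ?addr0 // => i ib.
by rewrite mxE (negbTE ib) mulr0.
Qed.

(** * The matrix equation modulo an ideal, by recursion on [j] *)

Section Relations.
Variables (K : fieldType) (A : lalgType K) (q : K) (n : nat).
Variables (x xs : 'I_n.+1 -> A).
(* Scalars are central; [malg] only has a canonical [lalgType] structure over
   a noncommutative monoid, so that this has to be assumed separately. *)
Hypothesis scaleAr : forall (a : K) (f g : A), f * (a *: g) = a *: (f * g).
Hypothesis q_neq0 : q != 0.
Hypothesis xs0 : xs ord0 = x ord0.

Variable I : A -> Prop.
Hypothesis idI : two_sided_ideal I.

Let U := u_mx q x xs.
Let s := sphere_s x xs.

(** Every entry of [U j] is 0 or a nonzero scalar multiple of a generator of index at most [j], and
    each such generator occurs. A linear condition on the entries is thus one on the generators; it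
    will be applied to q-commutation with a fixed element. *)
Lemma u_mx_linear_in_ideal (F : A -> A) j :
  (forall f g, F (f + g) = F f + F g) -> (forall a f, F (a *: f) = a *: F f) ->
  (j <= n)%N ->
  mx_in_ideal I (map_mx F (U j)) <->
  forall i : 'I_n.+1, (i <= j)%N -> I (F (x i)) /\ I (F (xs i)).
Proof.
move=> FD FZ; have F0 : F 0 = 0 by have := FZ 0 0; rewrite !scale0r.
have FS m f : map_mx F (f%:M : 'M_m) = (F f)%:M.
  by apply/matrixP => a b; rewrite !mxE; case: eqP.
elim: j => [_|j IH lt_jn].
  rewrite /U /= FS (mx_in_ideal_scalar idI) //.
  (* The only index is 0, where [xs0] merges the two conditions. *)
  split=> [Ix i|/(_ ord0 isT)[]//].
  rewrite leqn0 => /eqP i0; have -> : i = ord0 by apply: ord_inj.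
  by rewrite xs0.
have qV0 : q^-1 != 0 by rewrite invr_eq0.
have FqU : mx_in_ideal I (map_mx F ((q^-1)%:A *: U j)) <->
           mx_in_ideal I (map_mx F (U j)).
  split=> IM a b; have := IM a b; rewrite !mxE -scalerAl mul1r FZ;
    by rewrite idealZE.
have FNU : mx_in_ideal I (map_mx F (U j)) -> mx_in_ideal I (map_mx F (- U j)).
  move=> IM a b; have := IM a b; rewrite !mxE -scaleN1r FZ.
  by rewrite scaleN1r => /(idealN idI).
have {}IH := IH (ltnW lt_jn).
rewrite /U /= map_block_mx -/(U j) !FS mx_in_ideal_block.
rewrite !(mx_in_ideal_scalar idI) ?udim_gt0 // FqU.
split=> [[[/IH IU Ix] [Ixs _]] i|IF].
  rewrite leq_eqVlt ltnS => /predU1P [ij|]; last exact: IU.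
  have -> : i = inord j.+1 by apply: ord_inj; rewrite inordK.
  by split.
have IU : mx_in_ideal I (map_mx F (U j)).
  by apply/IH => i ij; apply: IF; rewrite (leq_trans ij).
have [|Ix Ixs] := IF (inord j.+1); first by rewrite inordK.
by split; split=> //; apply: FNU.
Qed.

Definition qcomm (f g : A) := f * g - q *: (g * f).

Definition sphere_comm (k : 'I_n.+1) :=
  (x k * xs k - xs k * x k) - (1 - q ^- 2) *: s k.-1.

(** Relations are grouped by their larger index [k], as one step of the recursion yields them. The
    last one, between [xs k] and [xs i], is the adjoint of the one between [x i] and [x k]. *)
Definition sphere_rels_upto j := forall k : 'I_n.+1, (0 < k <= j)%N ->
  I (sphere_comm k) /\ forall i : 'I_n.+1, (i < k)%N ->
    (I (qcomm (x i) (x k)) /\ I (qcomm (xs i) (x k))) /\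
    (I (qcomm (xs k) (x i)) /\ I (qcomm (xs k) (xs i))).

(** This matrix is the upper right block of the square of [U j.+1]. Its entries are [q^-1] times the
    q-commutators of the entries of [U j] with [y], hence linear in those entries. *)
Lemma u_mx_qcommr j (y : A) : (j <= n)%N ->
  mx_in_ideal I ((q^-1)%:A *: U j *m y%:M - y%:M *m U j) <->
  forall i : 'I_n.+1, (i <= j)%N -> I (qcomm (x i) y) /\ I (qcomm (xs i) y).
Proof.
move=> jn; pose F f := q^-1 *: qcomm f y.
have -> : (q^-1)%:A *: U j *m y%:M - y%:M *m U j = map_mx F (U j).
  apply/matrixP => a b; rewrite mul_scalar_mx mxE mulmx_scalarE !mxE.
  rewrite -scalerAl mul1r -scalerAl /F /qcomm scalerBr scalerA mulVf //.
  by rewrite scale1r.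
rewrite u_mx_linear_in_ideal //.
- split=> IF i /IF []; rewrite /F !(idealZE idI) ?invr_eq0 //.
- move=> f g; rewrite /F -scalerDr; congr (_ *: _).
  by rewrite /qcomm mulrDl mulrDr scalerDr opprD addrACA.
- move=> a f; rewrite /F scalerA [a * _]mulrC -scalerA; congr (_ *: _).
  by rewrite /qcomm -scalerAl scaleAr scalerA mulrC -scalerA -scalerBr.
Qed.

(** The same for the lower left block, where [y] will be [xs (inord j.+1)]. *)
Lemma u_mx_qcomml j (y : A) : (j <= n)%N ->
  mx_in_ideal I (y%:M *m ((q^-1)%:A *: U j) - U j *m y%:M) <->
  forall i : 'I_n.+1, (i <= j)%N -> I (qcomm y (x i)) /\ I (qcomm y (xs i)).
Proof.
move=> jn; pose F f := q^-1 *: qcomm y f.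
have -> : y%:M *m ((q^-1)%:A *: U j) - U j *m y%:M = map_mx F (U j).
  apply/matrixP => a b; rewrite mul_scalar_mx mxE [X in _ + X = _]mxE mulmx_scalarE !mxE.
  rewrite -scalerAl mul1r scaleAr /F /qcomm scalerBr scalerA mulVf //.
  by rewrite scale1r.
rewrite u_mx_linear_in_ideal //.
- split=> IF i /IF []; rewrite /F !(idealZE idI) ?invr_eq0 //.
- move=> f g; rewrite /F -scalerDr; congr (_ *: _).
  by rewrite /qcomm mulrDl mulrDr scalerDr opprD addrACA.
- move=> a f; rewrite /F scalerA [a * _]mulrC -scalerA; congr (_ *: _).
  by rewrite /qcomm -scalerAl scaleAr scalerA mulrC -scalerA -scalerBr.
Qed.

(** The scalar [t] is left free because each step down the recursion changes it. *)
Definition u_mx_square j t := mx_in_ideal I (U j *m U j - t%:M).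

Lemma u_mx_square_step j t : (j < n)%N ->
  let y := x (inord j.+1) in let ys := xs (inord j.+1) in
  u_mx_square j.+1 t <->
  [/\ u_mx_square j (t - ys * y),
      I (q ^- 2 *: (t - ys * y) + y * ys - t)
    & forall i : 'I_n.+1, (i <= j)%N ->
        (I (qcomm (x i) y) /\ I (qcomm (xs i) y)) /\
        (I (qcomm ys (x i)) /\ I (qcomm ys (xs i)))].
Proof.
move=> lt_jn y ys.
have qU : ((q^-1)%:A *: U j) *m ((q^-1)%:A *: U j) = (q ^- 2)%:A *: (U j *m U j).
  apply/matrixP => a b; rewrite !mxE mulr_sumr; apply: eq_bigr => i _.
  rewrite !mxE -!scalerAl !mul1r scaleAr scalerA.
  by rewrite -invfM -expr2.
(* The lower right block determines the square of [U j] modulo [I]. *)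
have dr : ys%:M *m y%:M + - U j *m - U j - t%:M =
          U j *m U j - (t - ys * y)%:M.
  rewrite mulNmx mulmxN opprK -scalar_mxM (addrC (_%:M)) -addrA.
  by rewrite [(t - _)%:M]raddfB /= opprB.
(* Substituting that square makes the upper left block a scalar matrix, so it amounts to a single
   relation. *)
have ul : u_mx_square j (t - ys * y) ->
    mx_in_ideal I ((q^-1)%:A *: U j *m ((q^-1)%:A *: U j) + y%:M *m ys%:M - t%:M)
    <-> I (q ^- 2 *: (t - ys * y) + y * ys - t).
  move=> sqj; rewrite -(mx_in_ideal_scalar idI _ (udim_gt0 j)).
  apply: mx_in_ideal_congr => // a b.
  have := idealZ idI (q ^- 2) (sqj a b); rewrite qU -scalar_mxM.
  congr I; rewrite !mxE -scalerAl mul1r.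
  case: eqP => _; rewrite ?mulr1n ?mulr0n ?subr0 ?addr0 //.
  by rewrite scalerBr -![_ + _ - t]addrA opprD addrACA subrr addr0.
pose M := block_mx ((q^-1)%:A *: U j) y%:M ys%:M (- U j).
have -> : u_mx_square j.+1 t = mx_in_ideal I (M *m M - block_mx t%:M 0 0 t%:M).
  by rewrite -scalar_mx_block.
rewrite mulmx_block opp_block_mx add_block_mx !oppr0 !addr0.
rewrite mx_in_ideal_block dr (mulmxN y%:M) (mulNmx (U j)).
rewrite u_mx_qcommr ?u_mx_qcomml 1?ltnW //.
split=> [[[uli Ir] [Il sqj]]|[sqj uli Irl]].
  split=> // [|i ij]; first by apply/ul.
  by split; [apply: Ir | apply: Il].
split; split=> //; [exact/ul | by move=> i /Irl[] | by move=> i /Irl[]].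
Qed.

Lemma sphere_rels_uptoS j : (j < n)%N ->
  sphere_rels_upto j.+1 <->
  [/\ sphere_rels_upto j, I (sphere_comm (inord j.+1))
    & forall i : 'I_n.+1, (i <= j)%N ->
        (I (qcomm (x i) (x (inord j.+1))) /\ I (qcomm (xs i) (x (inord j.+1)))) /\
        (I (qcomm (xs (inord j.+1)) (x i)) /\ I (qcomm (xs (inord j.+1)) (xs i)))].
Proof.
move=> lt_jn; have jE : (inord j.+1 : 'I_n.+1) = j.+1 :> nat by rewrite inordK.
split=> [R|[Rj Ic Iq] k /andP[k0]].
  have [|Ic Iq] := R (inord j.+1); first by rewrite jE leqnn.
  split=> // [k /andP[k0 kj]|i ij]; last by apply: Iq; rewrite jE.
  by apply: R; rewrite k0 ltnW.
rewrite leq_eqVlt ltnS => /predU1P [kj|kj]; last by apply: Rj; rewrite k0.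
have -> : k = inord j.+1 by apply: ord_inj; rewrite kj.
by split=> // i; rewrite jE ltnS; apply: Iq.
Qed.

(** Induction on [j] for all [t] at once: the step calls the hypothesis at [t - ys * y]. *)
Lemma u_mx_squareE j t : (j <= n)%N ->
  u_mx_square j t <-> I (s j - t) /\ sphere_rels_upto j.
Proof.
elim: j t => [|j IH] t jn.
  rewrite /u_mx_square /U /= -scalar_mxM -expr2 -[X in I X]/(x ord0 ^+ 2 - t).
  rewrite -raddfB (mx_in_ideal_scalar idI) //.
  by split=> [//|[]//]; split=> // k /andP[]; case: (k : nat).
have := IH (t - xs (inord j.+1) * x (inord j.+1)) (ltnW jn).
have := u_mx_square_step t jn; have := sphere_rels_uptoS jn.
set y := x _; set ys := xs _ => /= RS sqS.
(* The shift of [t] is exactly the increment of [s], so the condition on [s] passes unchanged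
   between levels. *)
have -> : s j - (t - ys * y) = s j.+1 - t by rewrite opprB addrA addrAC.
move=> {}IH.
(* The diagonal relation and the commutator relation differ by a multiple of [s j.+1 - t]. *)
have commE : I (s j.+1 - t) ->
    I (q ^- 2 *: (t - ys * y) + y * ys - t) <-> I (sphere_comm (inord j.+1)).
  move=> Is; apply: ideal_congr => //.
  suff -> : q ^- 2 *: (t - ys * y) + y * ys - t - sphere_comm (inord j.+1)
            = (1 - q ^- 2) *: (s j.+1 - t) by apply: idealZ.
  rewrite /sphere_comm inordK //= -/y -/ys -/(s j).
  have -> : s j + ys * y - t = s j - (t - ys * y) by rewrite opprB addrA.
  rewrite [(1 - _) *: (_ - _)]scalerBr [X in _ = _ - X]scalerBl scale1r.
  (* Summands 2 and 6 are [y * ys] and its opposite, which cancel. *)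
  by rewrite !opprB !addrA [LHS](ACl ((4*1*5*3)*(2*6))) /= subrr addr0.
split=> [/sqS [/IH [Is R] Ic Iq]|[Is /RS [R Ic Iq]]].
  by split=> //; apply/RS; split=> //; apply/commE.
by apply/sqS; split=> //; [apply/IH | apply/commE].
Qed.

Lemma square_rel_idealE :
  (forall f, square_rel (u_mx q x xs n) f -> I f) <->
  I (sphere_s x xs n - 1) /\ sphere_rels_upto n.
Proof.
apply: iff_trans (u_mx_squareE 1 (leqnn n)).
by split=> [IU a b|IU _ [a [b ->]]]; [apply: IU; exists a, b | apply: IU].
Qed.

End Relations.

(** * Self-adjointness of [u_mx] and adjoints of the sphere relations *)

Section SelfAdjoint.
Variables (K : numClosedFieldType) (A : lalgType K) (dag : A -> A) (q : K).
Variables (n : nat) (x xs : 'I_n.+1 -> A).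
Hypothesis starA : star_operation dag.
Hypothesis q_real : q^* = q.

Lemma star_op0 : dag 0 = 0.
Proof. by have := starZ starA 0 0; rewrite rmorph0 !scale0r. Qed.

Lemma star_opN f : dag (- f) = - dag f.
Proof. by rewrite -scaleN1r (starZ starA) rmorphN rmorph1 scaleN1r. Qed.

Lemma star_opB f g : dag (f - g) = dag f - dag g.
Proof. by rewrite (starD starA) star_opN. Qed.

(** Indeed [dag 1 = dag 1 * dag (dag 1) = dag (dag 1 * 1) = 1]. *)
Lemma star_op1 : dag 1 = 1.
Proof.
by rewrite -[LHS]mulr1 -{2}(starK starA 1) -(starM starA) mulr1 (starK starA).
Qed.

Lemma adjoint_scalar_mx m f : adjoint_mx dag (f%:M : 'M_m) = (dag f)%:M.
Proof.
by apply/matrixP => a b; rewrite !mxE eq_sym; case: eqP; rewrite ?star_op0.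
Qed.

Lemma adjoint_block_mx m1 m2 (M1 : 'M[A]_(m1, m1)) (M2 : 'M_(m1, m2))
    (M3 : 'M_(m2, m1)) (M4 : 'M_(m2, m2)) :
  adjoint_mx dag (block_mx M1 M2 M3 M4) =
  block_mx (adjoint_mx dag M1) (map_mx dag M3^T)
           (map_mx dag M2^T) (adjoint_mx dag M4).
Proof. by rewrite /adjoint_mx tr_block_mx map_block_mx. Qed.

Lemma scalar_mx_inj_pos m (f g : A) : (0 < m)%N ->
  f%:M = g%:M :> 'M_m -> f = g.
Proof.
by move=> m0 /matrixP /(_ (Ordinal m0) (Ordinal m0)); rewrite !mxE eqxx.
Qed.

Lemma adjoint_u_mx j : (j <= n)%N ->
  adjoint_mx dag (u_mx q x xs j) = u_mx q x xs j <->
  dag (x ord0) = x ord0 /\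
  forall i : 'I_n.+1, (0 < i <= j)%N -> dag (x i) = xs i.
Proof.
elim: j => [_|j IH lt_jn].
  rewrite /= adjoint_scalar_mx; split=> [/scalar_mx_inj_pos ->//|[->//]].
  by split=> // i; case: (i : nat).
have {}IH := IH (ltnW lt_jn).
set U := u_mx q x xs j in IH *.
have -> : u_mx q x xs j.+1 = block_mx ((q^-1)%:A *: U) (x (inord j.+1))%:M
            (xs (inord j.+1))%:M (- U) by [].
rewrite adjoint_block_mx -!/(adjoint_mx dag _%:M) !adjoint_scalar_mx.
have adjN : adjoint_mx dag (- U) = - adjoint_mx dag U.
  by apply/matrixP => a b; rewrite !mxE star_opN.
have adjq : adjoint_mx dag ((q^-1)%:A *: U) = (q^-1)%:A *: adjoint_mx dag U.
  apply/matrixP => a b; rewrite !mxE -!scalerAl !mul1r (starZ starA).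
  by rewrite fmorphV /= q_real.
rewrite adjN adjq; split=> [|[x0 xi]].
  (* The lower left block gives the condition on the top generator, the lower right block those on
     the earlier ones. *)
  case/eq_block_mx => _ _ /scalar_mx_inj_pos xE /oppr_inj /IH [x0 xi].
  split=> // i /andP[i0]; rewrite leq_eqVlt ltnS => /predU1P [ij|ij]; last first.
    by apply: xi; rewrite i0.
  have -> : i = inord j.+1 by apply: ord_inj; rewrite inordK.
  exact/xE/udim_gt0.
have xE : dag (x (inord j.+1)) = xs (inord j.+1) by apply: xi; rewrite inordK /=.
have -> : adjoint_mx dag U = U.
  by apply/IH; split=> // i /andP[i0 ij]; apply: xi; rewrite i0 ltnW.
by rewrite xE -xE (starK starA).
Qed.

Hypothesis dag_x : forall i, dag (x i) = xs i.
Hypothesis dag_x0 : dag (x ord0) = x ord0.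

Let dag_xs i : dag (xs i) = x i.
Proof. by rewrite -dag_x (starK starA). Qed.

Lemma star_sphere_s j : dag (sphere_s x xs j) = sphere_s x xs j.
Proof.
elim: j => [|j IH] /=; first by rewrite expr2 (starM starA) dag_x0.
by rewrite (starD starA) IH (starM starA) dag_x dag_xs.
Qed.

Variable I : A -> Prop.

(** Since [q] is real and each [s_j] is self-adjoint, [dag] fixes the commutator and [s_n] relations
    and permutes the mixed ones; only the relations among the [x i] have new adjoints, those among
    the [xs i]. *)
Lemma star_sphere_rel_idealE :
  (forall f, with_adjoints dag (sphere_rel q x xs) f -> I f) <->
  I (sphere_s x xs n - 1) /\ sphere_rels_upto q x xs I n.
Proof.
have xs0 : xs ord0 = x ord0 by rewrite -dag_x.
have dag_q f g : dag (f * g - q *: (g * f)) = dag g * dag f - q *: (dag f * dag g).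
  by rewrite star_opB (starZ starA) !(starM starA) q_real.
split=> [IR|[Is Iu]].
  have IRs f : sphere_rel q x xs f -> I f by move=> Rf; apply: IR; left.
  split=> [|k /andP[k0 _]]; first exact/IRs/sphere_rel_s.
  split=> [|i ik]; first exact/IRs/sphere_rel_comm.
  have ki : k != i by rewrite -val_eqE /= gtn_eqF.
  have ik' : i != k by rewrite eq_sym.
  split; split; try exact: IRs (sphere_rel_xx _ _ _ ik);
    try exact: IRs (sphere_rel_xsx _ _ _ _).
  (* The relation between [xs k] and [xs i] is available only as an adjoint. *)
  apply: IR; right; exists (x i * x k - q *: (x k * x i)).
    exact: sphere_rel_xx.
  by rewrite dag_q !dag_x.
have Iq (k i : 'I_n.+1) : (i < k)%N ->
    (I (qcomm q (x i) (x k)) /\ I (qcomm q (xs i) (x k))) /\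
    (I (qcomm q (xs k) (x i)) /\ I (qcomm q (xs k) (xs i))).
  by move=> ik; apply: (Iu k _).2 => //; rewrite leq_ord (leq_ltn_trans _ ik).
have Ixsx (i j : 'I_n.+1) : i != j -> I (qcomm q (xs i) (x j)).
  rewrite -val_eqE neq_ltn => /orP[/Iq [[]]//|/Iq [_ []]//].
have Icomm (i : 'I_n.+1) : (0 < i)%N -> I (sphere_comm q x xs i).
  by move=> i0; apply: (Iu i _).1; rewrite i0 leq_ord.
have dag_comm i : dag (sphere_comm q x xs i) = sphere_comm q x xs i.
  rewrite /sphere_comm !star_opB (starZ starA) star_sphere_s !(starM starA).
  by rewrite !dag_x !dag_xs rmorphB rmorph1 fmorphV rmorphXn /= q_real.
move=> _ [[i j /Iq[[]]|i j /Ixsx|i /Icomm|]//|[g [i j ij|i j ij|i i0|] ->]].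
- by rewrite dag_q !dag_x; have [_ []] := Iq _ _ ij.
- by rewrite dag_q dag_x dag_xs; apply: Ixsx; rewrite eq_sym.
- by rewrite -/(sphere_comm q x xs i) dag_comm; apply: Icomm.
- by rewrite star_opB star_op1 star_sphere_s.
Qed.

End SelfAdjoint.

(** * Equality of the two ideals, and the even and odd spheres *)

Lemma ideal_gen_square_sphere (K : numClosedFieldType) (A : lalgType K)
    (dag : A -> A) (q : K) n (x xs : 'I_n.+1 -> A) :
  star_operation dag -> q^* = q -> q != 0 ->
  (forall (a : K) (f g : A), f * (a *: g) = a *: (f * g)) ->
  (forall i, dag (x i) = xs i) -> dag (x ord0) = x ord0 ->
  forall f, ideal_gen (square_rel (u_mx q x xs n)) f <->
            ideal_gen (with_adjoints dag (sphere_rel q x xs)) f.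
Proof.
move=> sA qr q0 sAr dx dx0 f.
have xs0 : xs ord0 = x ord0 by rewrite -dx.
(* A given ideal contains either set of relations under the same conditions. *)
have E (I : A -> Prop) (idI : two_sided_ideal I) :=
  iff_trans (square_rel_idealE sAr q0 xs0 idI)
            (iff_sym (star_sphere_rel_idealE sA qr dx dx0 I)).
split=> If I idI IS; apply: If => //.
  exact/(E I idI).
exact/(E I idI).
Qed.

Lemma freealg_scalerAr (K : fieldType) (L : choiceType) (a : K)
    (f g : freealg K L) : f * (a *: g) = a *: (f * g).
Proof.
apply/malgP => w; rewrite mcoeffZ.
(* The support of [a *: g] shrinks when [a = 0]; summing over that of [g] gives both sides the same
   index sets. *)
rewrite (mcoeffMlw _ (fsubset_refl _) (msuppZ_le a g)) mcoeffMl mulr_sumr.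
apply: eq_bigr => v _; rewrite mulr_sumr; apply: eq_bigr => u _.
by rewrite mcoeffZ mulrCA mulrnAr.
Qed.

Theorem mainTheorem1 (R : realType) (q : R) (n : nat)
    (hq : q != 0) (hn : (1 <= n)%N) :
  (* Even spheres *)
  [/\ (* u_(2n)^* = u_(2n) in F *)
      adjoint_mx (even_star (K := R[i]) (n := n)) (even_u n (q%:C)%C)
        = even_u n (q%:C)%C,
      (* u^* = u only expresses that x_0^* = x_0 and (x_i)^* = x_i^* *)
      forall dag : freealg R[i] (even_letter n) -> freealg R[i] (even_letter n),
        star_operation dag ->
        (adjoint_mx dag (even_u n (q%:C)%C) = even_u n (q%:C)%C
         <-> dag (even_x R[i] ord0) = even_x R[i] ord0 /\
             forall i : 'I_n.+1, (0 < i)%N ->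
               dag (even_x R[i] i) = even_xs R[i] i)
    & (* the two ideals coincide *)
      forall f : freealg R[i] (even_letter n),
        ideal_gen (square_rel (even_u n (q%:C)%C)) f
        <-> ideal_gen (even_sphere_rel (q%:C)%C) f]
  (* Odd spheres *)
  /\ forall f : freealg R[i] (odd_letter n),
       ideal_gen (square_rel (odd_u n (q%:C)%C)) f
       <-> ideal_gen (odd_sphere_rel (q%:C)%C) f.
Proof.
have qr : ((q%:C)%C : R[i])^* = (q%:C)%C by exact: conjc_real.
have q0 : (q%:C)%C != 0 :> R[i] by rewrite fmorph_eq0.
split; last first.
  (* The general lemma applies with [x ord0 = 0], which is self-adjoint. *)
  apply: ideal_gen_square_sphere => //.
  - exact: odd_star_is_star.
  - exact: freealg_scalerAr.
  - exact: odd_star_x.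
  - by rewrite odd_star_x /odd_x /odd_xs unlift_none.
have dx0 : even_star (even_x R[i] (ord0 : 'I_n.+1)) = even_x R[i] ord0.
  by rewrite even_star_x /even_x /even_xs unlift_none.
have self_adjoint dag : star_operation dag ->
    adjoint_mx dag (even_u n (q%:C)%C) = even_u n (q%:C)%C <->
    dag (even_x R[i] ord0) = even_x R[i] ord0 /\
    forall i : 'I_n.+1, (0 < i)%N -> dag (even_x R[i] i) = even_xs R[i] i.
  move=> sd; rewrite /even_u adjoint_u_mx //.
  split=> -[d0 di]; split=> // i; last by case/andP=> /di.
  by move=> i0; apply: di; rewrite i0 leq_ord.
split=> //.
- apply/self_adjoint; first exact: even_star_is_star.
  by split=> // i _; apply: even_star_x.
- apply: ideal_gen_square_sphere => //.
  + exact: even_star_is_star.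
  + exact: freealg_scalerAr.
  + exact: even_star_x.
Qed.
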